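(* Let $\lambda=(\lambda_1>\dots>\lambda_r>0)$ be a strict partition with $r\le n$. Let $m=r$ if $n-r$ is even and $m=r+1$ if $n-r$ is odd, and set $\lambda_{r+1}=0$. Let $A_0(x_1,\dots,x_n)$ be the skew-symmetric $n\times n$ matrix with $(i,j)$ entry $(x_i-x_j)/(x_i\oplus x_j)$, let $B_\lambda$ be the $n\times m$ matrix with $(i,j)$ entry $[[x_i|b]]^{\lambda_{m-j+1}}(1+\beta x_i)^{-j}$, and let $A_\lambda(x_1,\dots,x_n|b)=\begin{pmatrix}A_0&B_\lambda\\-{}^tB_\lambda&0\end{pmatrix}$. Put $\mathrm{Pf}_0(x_1,\dots,x_n)=\mathrm{Pf}\,A_0(x_1,\dots,x_n)$ if $n$ is even and $\mathrm{Pf}\,A_0(x_1,\dots,x_n,0)$ if $n$ is odd. Then $$GQ_\lambda(x_1,\dots,x_n|b)=\prod_{i=1}^n(1+\beta x_i)^m\,\frac{\mathrm{Pf}\,A_\lambda(x_1,\dots,x_n|b)}{\mathrm{Pf}_0(x_1,\dots,x_n)},$$ and the same formula holds for $GP_\lambda(x_1,\dots,x_n|b)$ when $[[x|b]]^k$ is replaced by $[x|b]^k$ in the definition of $B_\lambda$.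
   Context: $\beta$ indeterminate, $b=(b_1,b_2,\dots)$ parameters; $x\oplus y=x+y+\beta xy$, $x\ominus y=(x-y)/(1+\beta y)$; $[x|b]^k=\prod_{i=1}^k(x\oplus b_i)$, $[[x|b]]^k=(x\oplus x)\prod_{i=1}^{k-1}(x\oplus b_i)$ (for $k=0$, interpret $[x|b]^0=1$ and $[[x|b]]^0=1$). $GP_\lambda(x_1,\dots,x_n|b)=\frac1{(n-r)!}\sum_{w\in S_n}w\big[\prod_{j=1}^r[x_j|b]^{\lambda_j}\prod_{i=1}^r\prod_{j=i+1}^n\frac{x_i\oplus x_j}{x_i\ominus x_j}\big]$ and $GQ_\lambda$ is the same with $[[x_j|b]]^{\lambda_j}$. $\mathrm{Pf}$ denotes the Pfaffian. *)

(* Defs.v *)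
From mathcomp Require Export all_boot all_order all_fingroup all_algebra.
From mathcomp Require Export mpoly.

Set Implicit Arguments.
Unset Strict Implicit.
Unset Printing Implicit Defensive.

Import GRing.Theory.
Local Open Scope ring_scope.

Definition strict_partition (lam : seq nat) : bool :=
  sorted gtn lam && all (fun k => 0 < k)%N lam.

(* 1/(2^k k!) * sum_(s in S_2k) sgn(s) prod_(i=1..k) A_(s(2i-1), s(2i)),
   for N = 2k; the size N is not required to be syntactically even, as it
   has to apply to block matrices of size n + m.  Meant for characteristic 0. *)
Definition Pf (F : fieldType) (N : nat) (A : 'M[F]_N) : F :=
  if odd N then 0 else
  (2 ^ N./2 * (N./2)`!)%:R^-1 *
  \sum_(s : 'S_N) (-1) ^+ s *
    \prod_(i < N | ~~ odd i) \prod_(j < N | j == i.+1 :> nat) A (s i) (s j).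

Section KTheoreticFunctions.
Variables (F : fieldType) (beta : F) (b : nat -> F).

Definition oadd (x y : F) : F := x + y + beta * x * y.
Definition osub (x y : F) : F := (x - y) / (1 + beta * y).

(* [x|b]^k and [[x|b]]^k.  The parameters are b 1, b 2, ...; b 0 is unused. *)
Definition powP (x : F) (k : nat) : F := \prod_(1 <= i < k.+1) oadd x (b i).
Definition powQ (x : F) (k : nat) : F :=
  if k == 0%N then 1 else oadd x x * \prod_(1 <= i < k) oadd x (b i).

(* Indices i : 'I_n are 0-based: lambda_(j+1) is nth 0 lam j, which is 0 for
   j >= r, the length of lambda.  The argument pw is powP or powQ. *)

Definition Gterm (pw : F -> nat -> F) (lam : seq nat) (n : nat)
    (x : 'I_n -> F) : F :=
  (\prod_(j < n | (j < size lam)%N) pw (x j) (nth 0%N lam j)) *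
  \prod_(i < n | (i < size lam)%N) \prod_(j < n | (i < j)%N)
     (oadd (x i) (x j) / osub (x i) (x j)).

Definition Gsum (pw : F -> nat -> F) (lam : seq nat) (n : nat)
    (x : 'I_n -> F) : F :=
  ((n - size lam)`!)%:R^-1 *
  \sum_(w : 'S_n) Gterm pw lam (fun i => x (w i)).

Definition GP := Gsum powP.
Definition GQ := Gsum powQ.

Definition A0 (n : nat) (x : 'I_n -> F) : 'M[F]_n :=
  \matrix_(i, j) ((x i - x j) / oadd (x i) (x j)).

Definition msize_lam (lam : seq nat) (n : nat) : nat :=
  if odd (n - size lam) then (size lam).+1 else size lam.

Definition Blam (pw : F -> nat -> F) (lam : seq nat) (n : nat)
    (x : 'I_n -> F) : 'M[F]_(n, msize_lam lam n) :=
  \matrix_(i, j)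
    (pw (x i) (nth 0%N lam (msize_lam lam n - j.+1)) *
     (1 + beta * x i) ^- j.+1).

Definition Alam (pw : F -> nat -> F) (lam : seq nat) (n : nat)
    (x : 'I_n -> F) : 'M[F]_(n + msize_lam lam n) :=
  block_mx (A0 x) (Blam pw lam x) (- (Blam pw lam x)^T) 0.

(* (x_1, ..., x_n, 0) *)
Definition append0 (n : nat) (x : 'I_n -> F) : 'I_n.+1 -> F :=
  fun i => oapp x 0 (unlift ord_max i).

Definition Pf0 (n : nat) (x : 'I_n -> F) : F :=
  if odd n then Pf (A0 (append0 x)) else Pf (A0 x).

End KTheoreticFunctions.

(* The field K(x_1, ..., x_n), its constants and its indeterminates. *)
Notation ratfun K n := {fraction {mpoly K[n]}}.

Definition rconst (K : fieldType) (n : nat) (c : K) : ratfun K n :=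
  tofrac (c%:MP_[n]).

Definition rvar (K : fieldType) (n : nat) (i : 'I_n) : ratfun K n :=
  tofrac ('X_i : {mpoly K[n]}).

(* Main.v *)
Require Import Defs.
From mathcomp Require Import ring zify.
Import GRing.Theory.
Local Open Scope ring_scope.

Set Implicit Arguments.
Unset Strict Implicit.
Unset Printing Implicit Defensive.

(** Write a(x,y) = (x - y)/(x (+) y).  In the coordinate u = x/(2 + beta x) this
    is (u - v)/(u + v), so Schur's Pfaffian evaluation gives
    Pf_0 = prod_(i<j) a(x_i,x_j); it follows by expanding the Pfaffian along its
    last column and using a partial fraction identity in an odd number of
    variables.  Expanding Pf A_lambda along its m last columns and evaluating the
    remaining minors by Schur's formula gives
      Pf A_lambda = 1/(n-m)! sum_w sgn(w) prod_(j<=m) B_(w(j),m-j+1)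
                      prod_(m<i<j) a(x_w(i),x_w(j)).
    Dividing by Pf_0, which is alternating, turns every summand into the one of
    GQ or GP with m in place of r.  When m = r + 1 the extra factors average to 1
    over the choice of the (r+1)-st variable, by the same partial fraction
    identity. *)

(** * Expansion of the Pfaffian along the last column *)

(** Injectivity is enough, since both sides have (n+1)! elements. Sums over permutations can then be
    split by the image of one point. *)
Lemma lift_perm_pair_bij (n : nat) (i : 'I_n.+1) :
  bijective (fun p : 'I_n.+1 * 'S_n => lift_perm i p.1 p.2).
Proof.
apply: inj_card_bij => [[j s] [k t] /= Est|]; last first.
  by rewrite card_prod !card_Sn card_ord factS.
have Ejk : j = k by rewrite -(lift_perm_id i j s) Est lift_perm_id.
rewrite -{}Ejk in Est *; congr (_, _); apply/permP => a; apply: (@lift_inj _ j).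
by rewrite -!(lift_perm_lift i) Est.
Qed.

Lemma sum_lift_perm (V : nmodType) (n : nat) (i : 'I_n.+1) (G : 'S_n.+1 -> V) :
  \sum_(s : 'S_n.+1) G s = \sum_(j < n.+1) \sum_(s : 'S_n) G (lift_perm i j s).
Proof.
rewrite pair_big (reindex (fun p : 'I_n.+1 * 'S_n => lift_perm i p.1 p.2)) //=.
exact/onW_bij/lift_perm_pair_bij.
Qed.

Lemma sum_perm_fix (V : nmodType) (n : nat) (i j : 'I_n.+1) (G : 'S_n.+1 -> V) :
  \sum_(s : 'S_n.+1 | s i == j) G s = \sum_(s : 'S_n) G (lift_perm i j s).
Proof.
rewrite big_mkcond (sum_lift_perm i) (bigD1 j) //= [X in _ + X]big1 ?addr0.
  by apply: eq_bigr => s _; rewrite lift_perm_id eqxx.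
move=> k /negPf kj; rewrite big1 // => s _.
by rewrite lift_perm_id kj.
Qed.

Section Pfaffian.
Variable F : fieldType.
Implicit Types (f : nat -> nat -> F).

(** The nested products of [Pf] are merged into one product over pairs, so that a permutation of
    positions can act on both coordinates at once. *)
Definition matching_term f (N : nat) (s : 'S_N) : F :=
  \prod_(p : 'I_N * 'I_N | ~~ odd p.1 && (p.2 == p.1.+1 :> nat)) f (s p.1) (s p.2).

Definition signed_term f (N : nat) (s : 'S_N) : F :=
  (-1) ^+ s * matching_term f s.

(** With entries indexed by [nat], deleting a row and its column is composition with [bump], and no
    casts between sizes arise. *)
Definition pfn (N : nat) f : F := Pf (\matrix_(i < N, j < N) f i j).

Lemma eq_pfn (N : nat) f g :
  (forall i j, (i < N)%N -> (j < N)%N -> f i j = g i j) -> pfn N f = pfn N g.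
Proof.
by move=> fg; congr Pf; apply/matrixP => i j; rewrite !mxE fg.
Qed.

Lemma pfnE (N : nat) f : ~~ odd N ->
  pfn N f = (2 ^ N./2 * (N./2)`!)%:R^-1 *
            \sum_(s : 'S_N) signed_term f s.
Proof.
rewrite /pfn /Pf => /negPf->; congr (_ * _); apply: eq_bigr => s _.
congr (_ * _); rewrite pair_big_dep /=; apply: eq_bigr => p _.
by rewrite mxE.
Qed.


(** Take for [h] the exchange of the block {q-1, q} with the last block {N, N+1}. It permutes the
    blocks of the matching and, as a product of two transpositions (or the identity), it is even. *)
Lemma signed_term_swap_pairs f (N : nat) (q : 'I_N.+2) :
  ~~ odd N -> odd q ->
  exists h : 'S_N.+2, [/\ h q = ord_max,
    forall i : 'I_N.+2, i.+1 = q -> h i = inord N &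
    forall s : 'S_N.+2, signed_term f (h * s)%g = signed_term f s].
Proof.
move=> evenN oddq; have [->|qmax] := eqVneq q ord_max.
  exists 1%g; split=> [|i [iN]|s]; rewrite ?mul1g ?perm1 //.
  by apply: val_inj; rewrite /= inordK.
have ltq : (q < N.+1)%N.
  by have := ltn_ord q; move/eqP: qmax => qmax; rewrite leq_eqVlt => /orP[/eqP[E]|//];
     case: qmax; apply: val_inj.
have ltq1 : (q.-1 < N.+2)%N by lia.
have ltN : (N < N.+2)%N by lia.
pose q' := Ordinal ltq1; pose m' := Ordinal ltN.
pose h : 'S_N.+2 := (tperm q ord_max * tperm q' m')%g.
have hE i : h i = (if i == q :> nat then N.+1 else if i == N.+1 :> nat then q : nat
             else if i == q.-1 :> nat then N else if i == N :> nat then q.-1 else i)%N :> nat.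
  rewrite /h permM; case: (tpermP q ord_max i) => [->|->|/eqP iq /eqP im] /=.
  - by rewrite eqxx tpermD // -val_eqE /=; lia.
  - rewrite tpermD //= -?val_eqE /=; try lia.
    by rewrite eqxx; case: eqP => // e; lia.
  - move: iq im; rewrite -!val_eqE /= => /negPf-> /negPf->.
    case: (tpermP q' m' i) => [->|->|/eqP iq /eqP im] /=; first by rewrite eqxx.
      by rewrite eqxx; case: eqP => // e; lia.
    by move: iq im; rewrite -!val_eqE /= => /negPf-> /negPf->.
exists h; split=> [|i iq|s].
- by apply: val_inj; rewrite /= hE eqxx.
- by apply: val_inj; rewrite /= inordK // hE; do !case: eqP; lia.
 rewrite /signed_term odd_permM.
have -> : odd_perm h = false.
  by rewrite odd_permM !odd_tperm -!val_eqE /=; lia.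
congr (_ * _); rewrite /matching_term.
rewrite [RHS](reindex_inj (h := fun p => (h p.1, h p.2))) /=; last first.
  by move=> [a b] [c d] [/perm_inj-> /perm_inj->].
apply: eq_big => [[i j]|[i j] _] /=; last by rewrite !permM.
have := ltn_ord i; have := ltn_ord j; rewrite !hE.
by do !case: eqP; lia.
Qed.

Lemma matching_term_recr f (N : nat) (s : 'S_N.+2) : ~~ odd N ->
  matching_term f s =
  f (s (inord N)) (s ord_max) *
  \prod_(p : 'I_N.+2 * 'I_N.+2 | [&& ~~ odd p.1, p.2 == p.1.+1 :> nat & (p.2 < N)%N])
     f (s p.1) (s p.2).
Proof.
move=> evenN; rewrite /matching_term (bigD1 (inord N, ord_max)) /=; last first.
  by rewrite inordK // evenN eqxx.
congr (_ * _); apply: eq_bigl => -[i j] /=.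
rewrite xpair_eqE -!val_eqE /= inordK //.
by have := ltn_ord i; have := ltn_ord j; lia.
Qed.

(** Two signs cancel: that of the transposition and that of the factor [f] at the last block. *)
Lemma signed_term_swap_last f (N : nat) (s : 'S_N.+2) :
  ~~ odd N -> (forall i j, f i j = - f j i) ->
  signed_term f (tperm (inord N) ord_max * s)%g = signed_term f s.
Proof.
move=> evenN fN; rewrite /signed_term odd_permM odd_tperm !matching_term_recr //.
have -> : (inord N : 'I_N.+2) != ord_max by rewrite -val_eqE /= inordK //; lia.
rewrite !permM tpermL tpermR fN signr_addb expr1 mulN1r !(mulNr, mulrN) opprK.
congr (_ * (_ * _)); apply: eq_bigr => -[i j] /= ij.
by rewrite !permM !tpermD // -val_eqE /= ?inordK //; lia.
Qed.

Lemma signed_term_orbit f (N : nat) (q : 'I_N.+2) :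
  ~~ odd N -> (forall i j, f i j = - f j i) ->
  exists h : 'S_N.+2, h q = ord_max /\
    forall s : 'S_N.+2, signed_term f (h * s)%g = signed_term f s.
Proof.
move=> evenN fN; have [oddq|evenq] := boolP (odd q).
  by have [h [hq _ hs]] := @signed_term_swap_pairs f N q evenN oddq; exists h.
have ltq : (q.+1 < N.+2)%N by have := ltn_ord q; lia.
have [//|h [hq hq' hs]] := @signed_term_swap_pairs f N (Ordinal ltq) evenN.
(* An even [q] opens its block: move the block to the end, then exchange its two points. *)
exists (h * tperm (inord N) ord_max)%g; split=> [|s].
  by rewrite permM hq' // tpermL.
by rewrite -mulgA hs signed_term_swap_last.
Qed.

(** Sort the permutations by the position sent to [ord_max]. By [signed_term_orbit] the N+2 classes
    have equal sums. *)
Lemma sum_signed_term f (N : nat) :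
  ~~ odd N -> (forall i j, f i j = - f j i) ->
  \sum_(s : 'S_N.+2) signed_term f s =
  (\sum_(s : 'S_N.+2 | s ord_max == ord_max) signed_term f s) *+ N.+2.
Proof.
move=> evenN fN.
transitivity (\sum_(q < N.+2) \sum_(s : 'S_N.+2 | s q == ord_max) signed_term f s).
  rewrite (exchange_big_dep xpredT) //=; apply: eq_bigr => s _.
  by rewrite (big_pred1 (s^-1 ord_max)%g) // => q; rewrite (can2_eq (permK s) (permKV s)).
rewrite (eq_bigr (fun=> \sum_(s : 'S_N.+2 | s ord_max == ord_max) signed_term f s)).
  by rewrite sumr_const card_ord.
move=> q _; have [h [hq hs]] := @signed_term_orbit f N q evenN fN.
rewrite (reindex_inj (mulgI h)) /=.
by apply: eq_big => [s|s _]; rewrite ?hs // permM hq.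
Qed.

(** The last block contributes the entry [f c N.+1]. The outer lift is even and the inner one has
    the parity of N + c, hence of c. *)
Lemma signed_term_lift f (N : nat) (c : 'I_N.+1) (s : 'S_N) : ~~ odd N ->
  signed_term f (lift_perm ord_max ord_max (lift_perm ord_max c s)) =
  (-1) ^+ c * f c N.+1 * signed_term (fun i j => f (bump c i) (bump c j)) s.
Proof.
move=> evenN; rewrite /signed_term !odd_lift_perm /= matching_term_recr //.
rewrite addbb (negPf evenN) /= signr_addb signr_odd lift_perm_id.
have -> : (inord N : 'I_N.+2) = lift ord_max ord_max.
  by apply: val_inj; rewrite /= inordK // /bump; case: leqP => //; lia.
rewrite lift_perm_lift lift_perm_id lift_max /=.
rewrite -!mulrA; congr (_ * _); rewrite mulrCA; congr (_ * (_ * _)).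
rewrite /matching_term; case: N c s evenN => [|N] c s evenN.
  by rewrite !big_pred0 // => -[[? h] ?]; rewrite ?andbF //; case: (h).
pose w (i : 'I_N.+1) : 'I_N.+3 := lift ord_max (lift ord_max i).
have wE i : w i = i :> nat by rewrite /w !lift_max.
rewrite [RHS](eq_bigr (fun p => f (lift_perm ord_max ord_max (lift_perm ord_max c s) (w p.1))
  (lift_perm ord_max ord_max (lift_perm ord_max c s) (w p.2)))); last first.
  by move=> p _; rewrite !lift_perm_lift !lift_max.
move: (w) wE => {}w wE; rewrite [LHS](reindex (fun p => (w p.1, w p.2))) /=.
  by apply: eq_bigl => -[i j]; rewrite /= !wE ltn_ord andbT.
exists (fun p : 'I_N.+3 * 'I_N.+3 => (inord p.1, inord p.2)) => -[i j] /=.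
  by move=> _; rewrite !wE !inord_val.
by rewrite inE /= => ij; congr (_, _); apply: val_inj; rewrite /= wE inordK //; lia.
Qed.

Hypothesis F_char0 : forall n : nat, n.+1%:R != 0 :> F.

Lemma pfn_expand (N : nat) f : ~~ odd N -> (forall i j, f i j = - f j i) ->
  pfn N.+2 f =
  \sum_(c < N.+1) (-1) ^+ c * f c N.+1 * pfn N (fun i j => f (bump c i) (bump c j)).
Proof.
move=> evenN fN; rewrite pfnE /= ?negbK // sum_signed_term // sum_perm_fix.
rewrite (sum_lift_perm ord_max) -[X in _ * X]mulr_natl mulrA.
(* The N+2 equal classes account exactly for the change of normalization. *)
have -> : (2 ^ N./2.+1 * (N./2.+1)`!)%:R^-1 * N.+2%:R = (2 ^ N./2 * (N./2)`!)%:R^-1 :> F.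
  have -> : (2 ^ N./2.+1 * (N./2.+1)`! = (2 ^ N./2 * (N./2)`!) * N.+2)%N.
    by rewrite expnS factS -[in N.+2](even_halfK evenN); lia.
  by rewrite natrM invfM mulfVK.
rewrite mulr_sumr; apply: eq_bigr => c _; rewrite pfnE //.
rewrite [in RHS]mulrCA; congr (_ * _).
rewrite [in RHS]mulr_sumr; apply: eq_bigr => s _; exact: signed_term_lift.
Qed.

End Pfaffian.

(** * Schur's Pfaffian *)

Lemma prod_neq_lift (R : comPzRingType) (n : nat) (k : 'I_n.+1) (G : 'I_n.+1 -> R) :
  \prod_(j | j != k) G j = \prod_(i < n) G (lift k i).
Proof.
rewrite big_mkcond (bigD1_ord k) //= eqxx mul1r; apply: eq_bigr => i _.
by rewrite eq_sym neq_lift.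
Qed.

Section PairProduct.
Variable F : comPzRingType.

Definition pair_prod (n : nat) (g : 'I_n -> 'I_n -> F) : F :=
  \prod_(i < n) \prod_(j < n | (i < j)%N) g i j.

Lemma eq_pair_prod (n : nat) (g h : 'I_n -> 'I_n -> F) :
  (forall i j, g i j = h i j) -> pair_prod g = pair_prod h.
Proof. by move=> gh; apply: eq_bigr => i _; apply: eq_bigr. Qed.

(** The sign comes from reversing the k factors in which index k stands second. *)
Lemma pair_prod_lift (n : nat) (g : 'I_n.+1 -> 'I_n.+1 -> F) (k : 'I_n.+1) :
  (forall i j, g i j = - g j i) ->
  pair_prod g = (-1) ^+ k * pair_prod (fun i j => g (lift k i) (lift k j)) *
                \prod_(i < n) g k (lift k i).
Proof.
move=> gN; rewrite /pair_prod (bigD1_ord k) //= [in LHS]big_mkcond (bigD1_ord k) //=.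
rewrite ltnn mul1r.
under [X in _ * X = _]eq_bigr => i _ do rewrite big_mkcond (bigD1_ord k) //=.
rewrite big_split /= mulrA -big_split /=.
under [X in X * _ = _]eq_bigr => i _.
  have -> : (if (k < bump k i)%N then g k (lift k i) else 1) *
            (if (bump k i < k)%N then g (lift k i) k else 1) =
            (if (i < k)%N then -1 else 1) * g k (lift k i).
    rewrite /bump; case: (leqP k i) => ki; rewrite /= ?add0n ?add1n.
      by rewrite ltnS ki ltnNge (leqW ki) /= mulr1 mul1r.
    by rewrite ltnNge (ltnW ki) ki /= mul1r mulN1r gN.
  over.
rewrite big_split /= -big_mkcond -(big_ord_widen n (fun=> -1)) ?prodr_const ?card_ord;
  last by rewrite -ltnS.
rewrite mulrAC; congr (_ * _ * _).
apply: eq_bigr => i _; rewrite [RHS]big_mkcond; apply: eq_bigr => j _ /=.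
by congr (if _ then _ else _); rewrite /bump; lia.
Qed.

(** Induction on n: isolate index 0 on the left and its image k on the right; the sign (-1)^k is the
    one in [odd_lift_perm]. *)
Lemma pair_prod_perm (n : nat) (g : 'I_n -> 'I_n -> F) (w : 'S_n) :
  (forall i j, g i j = - g j i) ->
  pair_prod (fun i j => g (w i) (w j)) = (-1) ^+ w * pair_prod g.
Proof.
elim: n g w => [|n IHn] g w gN.
  have -> : w = 1%g by apply/permP => -[].
  by rewrite odd_perm1 mul1r; apply: eq_pair_prod => i j; rewrite !perm1.
have [f _ fK] := lift_perm_pair_bij (@ord0 n).
rewrite -(fK w); case: (f w) => k v /= {fK f w}.
rewrite (pair_prod_lift ord0) // (pair_prod_lift k) // mul1r odd_lift_perm /=.
rewrite -[in RHS](signr_odd _ k) signr_addb lift_perm_id.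
rewrite (eq_pair_prod (h := fun i j => g (lift k (v i)) (lift k (v j)))); last first.
  by move=> i j; rewrite !lift_perm_lift.
rewrite (IHn (fun i j => g (lift k i) (lift k j))) //.
rewrite [X in _ = _ * (_ * X)](reindex_inj (@perm_inj _ v)) /=.
under eq_bigr => i _ do rewrite lift_perm_lift.
by rewrite !mulrA (mulrAC (_ ^+ odd k)) -signr_addb addbb mul1r.
Qed.

End PairProduct.

(** * Partial fractions in an odd number of variables *)

Section LagrangeIdentity.
Variables (F : fieldType) (n : nat).
Hypothesis two_neq0 : 2%:R != 0 :> F.
Hypothesis oddn : odd n.

Section Poly.
Variable u : 'I_n -> F.
Hypothesis u_neq0 : forall i, u i != 0.
Hypothesis u_neq : forall i j, i != j -> u i != u j.

Let c k := \prod_(j | j != k) ((u k + u j) / (u k - u j)).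

Lemma odd_prodN (G : 'I_n -> F) : \prod_i (- G i) = - \prod_i G i.
Proof.
by rewrite prodrN card_ord -signr_odd oddn mulN1r.
Qed.

(** This is the partial fraction decomposition of 1 - prod (X - u_i)/(X + u_i), cleared of
    denominators. The leading terms on the left cancel, so both sides have degree below n, and they
    agree at the n distinct points -u_k. *)
Lemma lagrange_poly :
  \prod_i ('X + (u i)%:P) - \prod_i ('X - (u i)%:P) =
  2%:R *: \sum_k (c k * u k) *: \prod_(j | j != k) ('X + (u j)%:P).
Proof.
apply/eqP; rewrite -subr_eq0; apply/eqP.
set D := (X in X = 0).
have evalD k : root D (- u k).
  have -> : root D (- u k) = (D.[- u k] == 0) by [].
  rewrite /D hornerD hornerN hornerD hornerN hornerZ horner_sum !horner_prod.
  rewrite (bigD1 k) //= hornerD hornerX hornerC addNr mul0r sub0r.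
  under eq_bigr => j _ do rewrite hornerD hornerX hornerN hornerC -opprD.
  rewrite odd_prodN opprK (bigD1 k) //=.
  rewrite [X in _ - 2%:R * X](bigD1 k) //= [X in _ - 2%:R * (_ + X)]big1 ?addr0; last first.
    move=> j jk; rewrite hornerZ horner_prod (bigD1 k) 1?eq_sym //=.
    by rewrite hornerD hornerX hornerC addNr mul0r mulr0.
  rewrite hornerZ horner_prod /c.
  set P := \prod_(j | _) (u k + u j).
  have -> : \prod_(j | j != k) ('X + (u j)%:P).[- u k] = \prod_(j | j != k) (u k - u j).
    transitivity (\prod_(j | j != k) - (u k - u j)).
      by apply: eq_bigr => j _; rewrite hornerD hornerX hornerC opprB addrC.
    rewrite prodrN cardC1 card_ord -signr_odd.
    have -> : odd n.-1 = false by case: (n) oddn => //= m /negPf.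
    by rewrite mul1r.
  rewrite big_split /= prodfV -/P.
  have : \prod_(j | j != k) (u k - u j) != 0.
    by apply/prodf_neq0 => j jk; rewrite subr_eq0 u_neq // eq_sym.
  by set Q := \prod_(j | _) (u k - u j) => Q0; apply/eqP; field.
apply: (@roots_geq_poly_eq0 _ D [seq - u k | k <- enum 'I_n]).
- by apply/allP => _ /mapP[k _ ->].
- rewrite map_inj_uniq ?enum_uniq // => i j /oppr_inj.
  by apply: contra_eq; apply: u_neq.
rewrite size_map size_enum_ord.
have szX (v : 'I_n -> F) (P : pred 'I_n) :
  size (\prod_(j | P j) ('X + (v j)%:P)) = #|P|.+1.
  have := size_prod_XsubC (enum P) (fun j => - v j).
  by rewrite big_enum -cardE; under eq_bigr do rewrite polyCN opprK.
have coefn (v : 'I_n -> F) : (\prod_j ('X + (v j)%:P))`_n = 1.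
  have /monicP : \prod_j ('X + (v j)%:P) \is monic.
    by apply: monic_prod => j _; rewrite -[_%:P]opprK -polyCN monicXsubC.
  by rewrite lead_coefE szX card_ord.
have coefp (v : 'I_n -> F) i : (n < i)%N -> (\prod_j ('X + (v j)%:P))`_i = 0.
  by move=> ni; rewrite nth_default // szX card_ord.
have ED : \prod_i ('X - (u i)%:P) = \prod_i ('X + (- u i)%:P).
  by apply: eq_bigr => i _; rewrite polyCN.
apply/leq_sizeP => i ni; rewrite /D ED coefB coefZ coef_sum [X in _ - _ * X]big1 ?mulr0 ?subr0.
  rewrite coefB; move: ni; rewrite leq_eqVlt => /orP[/eqP<-|ni].
    by rewrite !coefn subrr.
  by rewrite !coefp // subrr.
move=> k _; rewrite coefZ nth_default ?mulr0 // szX cardC1 card_ord.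
by case: (n) oddn ni.
Qed.

(** Evaluate [lagrange_poly] at 0: as n is odd, the left side is twice the product of the u_i. *)
Lemma sum_lagrange : \sum_k c k = 1.
Proof.
have := congr1 (horner^~ 0) lagrange_poly => /=.
rewrite hornerD hornerN hornerZ horner_sum !horner_prod.
under eq_bigr => i _ do rewrite hornerD hornerX hornerC add0r.
under [X in _ - X]eq_bigr => i _ do rewrite hornerD hornerX hornerN hornerC add0r.
rewrite odd_prodN opprK.
rewrite [X in _ = _ * X](eq_bigr (fun k => c k * \prod_i u i)); last first.
  move=> k _; rewrite hornerZ horner_prod (bigD1 k (P := xpredT)) //= mulrA.
  by congr (_ * _); apply: eq_bigr => i _; rewrite hornerD hornerX hornerC add0r.
rewrite -mulr_suml mulrA => E.
have u0 : \prod_i u i != 0 by apply/prodf_neq0.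
apply: (mulfI two_neq0); apply: (mulIf u0); rewrite -E; ring.
Qed.

(** By [sum_lagrange] the product of the X + u_i may be spread over k with weights c_k; then X + u_k
    - 2 u_k = X - u_k. *)
Lemma lagrange_poly_odd :
  \sum_k c k *: (('X - (u k)%:P) * \prod_(j | j != k) ('X + (u j)%:P)) =
  \prod_i ('X - (u i)%:P).
Proof.
have -> : \prod_i ('X - (u i)%:P) = \prod_i ('X + (u i)%:P) -
  2%:R *: \sum_k (c k * u k) *: \prod_(j | j != k) ('X + (u j)%:P).
  by rewrite -lagrange_poly opprB addrCA subrr addr0.
have -> : \prod_i ('X + (u i)%:P) = \sum_k c k *: \prod_i ('X + (u i)%:P).
  by rewrite -scaler_suml sum_lagrange scale1r.
rewrite scaler_sumr -sumrB; apply: eq_bigr => k _.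
rewrite [in RHS](bigD1 k (P := xpredT)) //= -!mul_polyC !polyCM; ring.
Qed.

Lemma lagrange_odd (z : F) : (forall i, z + u i != 0) ->
  \sum_k c k * ((z - u k) / (z + u k)) = \prod_i ((z - u i) / (z + u i)).
Proof.
move=> zu; have := congr1 (horner^~ z) lagrange_poly_odd => /=.
rewrite horner_sum horner_prod => E.
have nz : \prod_i (z + u i) != 0 by apply/prodf_neq0.
apply: (mulIf nz); rewrite big_split /= prodfV mulfVK // mulr_suml.
transitivity (\prod_i ('X - (u i)%:P).[z]); last first.
  by apply: eq_bigr => i _; rewrite hornerD hornerX hornerN hornerC.
rewrite -E; apply: eq_bigr => k _.
rewrite hornerZ hornerM hornerD hornerX hornerN hornerC horner_prod (bigD1 k) //=.
under [in RHS]eq_bigr => i _ do rewrite hornerD hornerX hornerC.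
by field.
Qed.

End Poly.

(* Homogeneous in (z, w), so that (1, beta) is allowed even for beta = 0. *)
Lemma lagrange_odd_homog (u : 'I_n -> F) (w z : F) :
  (forall i, u i != 0) -> (forall i j, i != j -> u i != u j) ->
  (forall i, z + w * u i != 0) ->
  \sum_k \prod_(j | j != k) ((u k + u j) / (u k - u j)) *
     ((z - w * u k) / (z + w * u k)) =
  \prod_i ((z - w * u i) / (z + w * u i)).
Proof.
move=> u0 uneq zu; have [w0|w0] := eqVneq w 0.
  have z0 : z != 0.
    have n0 : (0 < n)%N by case: (n) oddn.
    by have := zu (Ordinal n0); rewrite w0 mul0r addr0.
  rewrite [RHS]big1; last by move=> i _; rewrite w0 mul0r subr0 addr0 divff.
  apply: etrans (sum_lagrange u0 uneq); apply: eq_bigr => k _.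
  by rewrite w0 mul0r subr0 addr0 divff ?mulr1.
(* The weights are homogeneous of degree 0, so scaling [u] by [w] leaves them unchanged. *)
have wu0 i : w * u i != 0 by rewrite mulf_neq0.
have wuneq i j : i != j -> w * u i != w * u j.
  by move=> ij; rewrite (inj_eq (mulfI w0)) uneq.
apply: etrans (lagrange_odd wu0 wuneq zu).
apply: eq_bigr => k _; congr (_ * _); apply: eq_bigr => j _.
by rewrite -mulrDr -mulrBr -mulf_div divff // mul1r.
Qed.

End LagrangeIdentity.

(** * The coordinate u and Schur's evaluation *)

Section Schur.
Variables (F : fieldType) (beta : F).
Hypothesis F_char0 : forall n : nat, n.+1%:R != 0 :> F.

Definition ratio (x y : F) : F := (x - y) / oadd beta x y.

Lemma oaddC (x y : F) : oadd beta x y = oadd beta y x.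
Proof. by rewrite /oadd; ring. Qed.

Lemma ratioC (x y : F) : ratio x y = - ratio y x.
Proof. by rewrite /ratio oaddC -mulNr opprB. Qed.

(** A condition on points of a field rather than on indeterminates, so that the inductions may pass
    to subfamilies. The factor 2 + beta y is the denominator of [ucoord]. *)
Definition generic (n : nat) (y : 'I_n -> F) : Prop :=
  [/\ forall i, y i != 0, forall i, 2%:R + beta * y i != 0,
      forall i j, i != j -> y i != y j &
      forall i j, i != j -> oadd beta (y i) (y j) != 0].

Lemma generic_inj (n p : nat) (y : 'I_n -> F) (h : 'I_p -> 'I_n) :
  injective h -> generic y -> generic (y \o h).
Proof.
move=> h_inj [y0 y2 yneq yadd]; split=> [i|i|i j ij|i j ij] //=.
  by apply: yneq; rewrite (inj_eq h_inj).
by apply: yadd; rewrite (inj_eq h_inj).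
Qed.

Definition ucoord (y : F) : F := y / (2%:R + beta * y).

Lemma ratio_ucoord (x y : F) :
  2%:R + beta * x != 0 -> 2%:R + beta * y != 0 -> oadd beta x y != 0 ->
  ucoord x + ucoord y != 0 /\
  ratio x y = (ucoord x - ucoord y) / (ucoord x + ucoord y).
Proof.
move=> x2 y2 xy; have two := F_char0 1.
have E : ucoord x + ucoord y =
    2%:R * oadd beta x y / ((2%:R + beta * x) * (2%:R + beta * y)).
  by rewrite /ucoord /oadd; field; rewrite x2 y2.
have E' : ucoord x - ucoord y =
    2%:R * (x - y) / ((2%:R + beta * x) * (2%:R + beta * y)).
  by rewrite /ucoord; field; rewrite x2 y2.
have nz : ucoord x + ucoord y != 0.
  by rewrite E !mulf_neq0 // invr_eq0 mulf_neq0.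
split=> //; rewrite E E' /ratio; field.
by rewrite xy x2 y2 two.
Qed.

Lemma ucoord_inj (x y : F) : 2%:R + beta * x != 0 -> 2%:R + beta * y != 0 ->
  ucoord x = ucoord y -> x = y.
Proof.
move=> x2 y2 /eqP; rewrite /ucoord eqr_div // => /eqP E.
apply: (mulfI (F_char0 1)); apply/eqP; rewrite -subr_eq0; apply/eqP.
by rewrite -(subrr (x * (2%:R + beta * y))) {2}E; ring.
Qed.

Section OddSums.
Variables (n : nat) (y : 'I_n -> F).
Hypotheses (oddn : odd n) (gen_y : generic y).

Lemma ucoord_lagrange (w z : F) :
  (forall i, z + w * ucoord (y i) != 0) ->
  \sum_k \prod_(j | j != k) (ratio (y k) (y j))^-1 *
     ((z - w * ucoord (y k)) / (z + w * ucoord (y k))) =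
  \prod_i ((z - w * ucoord (y i)) / (z + w * ucoord (y i))).
Proof.
have [y0 y2 yneq yadd] := gen_y => zw.
have u0 i : ucoord (y i) != 0 by rewrite mulf_neq0 ?invr_eq0.
have uneq i j : i != j -> ucoord (y i) != ucoord (y j).
  by move=> ij; apply: contra_neq (yneq i j ij); apply: ucoord_inj.
apply: etrans (lagrange_odd_homog (F_char0 1) oddn u0 uneq zw).
apply: eq_bigr => k _; congr (_ * _); apply: eq_bigr => j jk.
by rewrite (ratio_ucoord _ _ _).2 ?invf_div // yadd // eq_sym.
Qed.

(** The case w = 1 of [ucoord_lagrange], at the coordinate of z; it drives the induction for Schur's
    Pfaffian. *)
Lemma sum_ratio (z : F) : 2%:R + beta * z != 0 ->
  (forall i, oadd beta (y i) z != 0) ->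
  \sum_k \prod_(j | j != k) (ratio (y k) (y j))^-1 * ratio (y k) z =
  \prod_i ratio (y i) z.
Proof.
have [y0 y2 yneq yadd] := gen_y => z2 yz.
have E i : ratio (y i) z =
    - ((ucoord z - 1 * ucoord (y i)) / (ucoord z + 1 * ucoord (y i))).
  by rewrite ratioC (ratio_ucoord _ _ _).2 ?(oaddC z) // mul1r.
rewrite [RHS](eq_bigr _ (fun i _ => E i)) odd_prodN // -ucoord_lagrange.
  by rewrite -sumrN; apply: eq_bigr => k _; rewrite E mulrN.
by move=> i; rewrite mul1r addrC (ratio_ucoord _ _ _).1.
Qed.

(** The case (z, w) = (1, beta) of [ucoord_lagrange], since (1 - beta u)/(1 + beta u) = 1/(1 + beta
    y). It serves to absorb the added zero part. *)
Lemma sum_ratio_inv : (forall i, 1 + beta * y i != 0) ->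
  \sum_k \prod_(j | j != k) (ratio (y k) (y j))^-1 * (1 + beta * y k)^-1 =
  \prod_i (1 + beta * y i)^-1.
Proof.
have [y0 y2 yneq yadd] := gen_y => y1; have two := F_char0 1.
have E i : (1 + beta * ucoord (y i)) = 2%:R * (1 + beta * y i) / (2%:R + beta * y i).
  by rewrite /ucoord; field.
have E' i : (1 + beta * y i)^-1 =
    (1 - beta * ucoord (y i)) / (1 + beta * ucoord (y i)).
  rewrite E /ucoord; field; by rewrite y1 y2 two.
rewrite [RHS](eq_bigr _ (fun i _ => E' i)) -ucoord_lagrange.
  by apply: eq_bigr => k _; rewrite E'.
by move=> i; rewrite E !mulf_neq0 ?invr_eq0.
Qed.

End OddSums.

Definition vand (n : nat) (x : nat -> F) : F :=
  pair_prod (fun i j : 'I_n => ratio (x i) (x j)).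

Lemma vand_recr (n : nat) (x : nat -> F) :
  vand n.+1 x = vand n x * \prod_(i < n) ratio (x i) (x n).
Proof.
rewrite /vand (pair_prod_lift ord_max) => [|i j]; last exact: ratioC.
rewrite mulrAC mulrC; congr (_ * _).
  by apply: eq_pair_prod => i j; rewrite !lift_max.
under eq_bigr => i _ do rewrite lift_max ratioC.
by rewrite prodrN card_ord mulrA -signr_odd -signr_addb addbb mul1r.
Qed.

Lemma vand_lift (n : nat) (x : nat -> F) (k : 'I_n.+1) :
  vand n.+1 x = (-1) ^+ k * vand n (x \o bump k) *
    \prod_(j < n.+1 | j != k) ratio (x k) (x j).
Proof.
rewrite prod_neq_lift /vand (pair_prod_lift k) // => i j; exact: ratioC.
Qed.

(** Each minor of the column expansion is [vand] of the points without x_k; divided by [vand n.+1 x]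
    it becomes, up to sign, a weight of [sum_ratio]. The conditions on the last point allow it to be
    0, as [Pf0] requires for odd n. *)
Lemma schur_step (n : nat) (x : nat -> F) : ~~ odd n ->
  (forall y : nat -> F, generic (fun i : 'I_n => y i) ->
     pfn n (fun i j => ratio (y i) (y j)) = vand n y) ->
  generic (fun i : 'I_n.+1 => x i) ->
  2%:R + beta * x n.+1 != 0 ->
  (forall i : 'I_n.+1, oadd beta (x i) (x n.+1) != 0) ->
  pfn n.+2 (fun i j => ratio (x i) (x j)) = vand n.+2 x.
Proof.
move=> evenn IH genx x2 xadd; rewrite pfn_expand // => [|i j]; last exact: ratioC.
rewrite vand_recr -(sum_ratio _ genx x2 xadd) ?oddS // mulr_sumr.
apply: eq_bigr => k _; rewrite (IH (x \o bump k)); last first.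
  exact: (generic_inj (@lift_inj _ k) genx).
have [_ _ xneq xadd'] := genx.
rewrite (vand_lift _ k) prodfV.
have : \prod_(j < n.+1 | j != k) ratio (x k) (x j) != 0.
  apply/prodf_neq0 => j jk; rewrite /ratio mulf_neq0 ?invr_eq0 ?subr_eq0 //.
    by apply: xneq; rewrite eq_sym.
  by apply: xadd'; rewrite eq_sym.
by set P := \prod_(j < _ | _) _ => P0; field.
Qed.

Lemma schur_pfaffian (n : nat) (x : nat -> F) : ~~ odd n ->
  generic (fun i : 'I_n => x i) ->
  pfn n (fun i j => ratio (x i) (x j)) = vand n x.
Proof.
elim/ltn_ind: n x => -[|[|n]] // IH x evenn genx.
  rewrite pfnE // /vand /pair_prod big_ord0.
  rewrite (big_pred1 1%g) => [|s]; last by apply/esym/eqP/permP => -[].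
  rewrite /signed_term odd_perm1 /matching_term big_pred0 => [|[[]]] //.
  by rewrite expr0 !mulr1 invr1.
rewrite /= negbK in evenn.
have [_ x2 _ xadd] := genx.
apply: schur_step => //.
- by move=> y; apply: IH.
- apply: (generic_inj (h := widen_ord (leqnSn n.+1))) genx.
  by move=> i j /(congr1 val)/= /val_inj.
- exact: (x2 ord_max).
move=> i; apply: (xadd (widen_ord (leqnSn n.+1) i) ord_max).
by rewrite -val_eqE /= neq_ltn ltn_ord.
Qed.

(** The appended point changes nothing, because [ratio] of x and 0 is x/x = 1. *)
Lemma schur_pfaffian_odd (n : nat) (x : nat -> F) : odd n ->
  generic (fun i : 'I_n => x i) -> x n = 0 ->
  pfn n.+1 (fun i j => ratio (x i) (x j)) = vand n x.
Proof.
case: n => // n /= evenn genx xn; have [x0 _ _ _] := genx.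
have xadd i : oadd beta (x i) 0 = x i by rewrite /oadd; ring.
rewrite schur_step //; first last.
- by move=> i; rewrite xn xadd.
- by rewrite xn mulr0 addr0 F_char0.
- by move=> y; apply: schur_pfaffian.
rewrite vand_recr big1 ?mulr1 // => i _.
by rewrite xn /ratio xadd subr0 divff.
Qed.

(** * Pfaffians with a border of columns *)

Definition bordered (n : nat) (x : nat -> F) (B : nat -> nat -> F) (i j : nat) : F :=
  if (i < n)%N then if (j < n)%N then ratio (x i) (x j) else B i (j - n)%N
  else if (j < n)%N then - B j (i - n)%N else 0.

Lemma borderedC (n : nat) (x : nat -> F) B i j :
  bordered n x B i j = - bordered n x B j i.
Proof.
rewrite /bordered; do 2!case: ltnP => _; rewrite ?opprK ?oppr0 //; exact: ratioC.
Qed.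

(** Induction on m: expanding along the last border column removes that column and one variable,
    which leaves n - m unchanged. For m = 0 all n! summands equal Schur's product. *)
Lemma pfn_bordered (m n : nat) (x : nat -> F) (B : nat -> nat -> F) :
  (m <= n)%N -> ~~ odd (n - m) -> generic (fun i : 'I_n => x i) ->
  pfn (n + m) (bordered n x B) =
  ((n - m)`!)%:R^-1 * \sum_(w : 'S_n) (-1) ^+ w *
    (\prod_(j < n | (j < m)%N) B (w j) (m - j.+1)%N *
     \prod_(i < n | (m <= i)%N) \prod_(j < n | (i < j)%N) ratio (x (w i)) (x (w j))).
Proof.
elim: m n x B => [|m IH] n x B.
  rewrite addn0 subn0 => _ evenn genx.
  rewrite (eq_pfn (g := fun i j => ratio (x i) (x j))); last first.
    by move=> i j ni nj; rewrite /bordered ni nj.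
  rewrite schur_pfaffian //.
  rewrite (eq_bigr (fun=> vand n x)) => [|w _].
    rewrite sumr_const card_Sn -[X in _ * X]mulr_natl mulKf //.
    by rewrite -(prednK (fact_gt0 n)).
  rewrite [X in _ * (X * _)]big_pred0 // mul1r /=.
  have := @pair_prod_perm F n (fun i j => ratio (x i) (x j)) w (fun i j => ratioC _ _).
  rewrite /pair_prod => ->.
  by rewrite mulrA -signr_addb addbb mul1r.
case: n => // n; rewrite ltnS subSS => mn evenn genx.
rewrite addSn addnS pfn_expand //; [|by lia|exact: borderedC].
have ltnm : ((n + m).+1 < n.+1)%N = false by lia.
(* Border rows meet the last column in the zero block, so only rows of variables remain. *)
rewrite (bigID (fun c : 'I__ => (c < n.+1)%N)) /= [X in _ + X]big1 ?addr0; last first.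
  by move=> c nc; rewrite /bordered (negPf nc) ltnm mulr0 mul0r.
rewrite -(big_ord_widen _ (fun c => (-1) ^+ c * bordered n.+1 x B c (n + m).+1 *
  pfn (n + m) (fun i j => bordered n.+1 x B (bump c i) (bump c j)))); last by lia.
(* The row k paired with the last border column becomes the image of 0; hence the columns are read
   in reverse order. *)
rewrite (sum_lift_perm ord0) mulr_sumr; apply: eq_bigr => k _.
rewrite (eq_pfn (g := bordered n (x \o bump k) (fun i j => B (bump k i) j))); last first.
  move=> i j _ _; have kn : (k <= n)%N by rewrite -ltnS.
  have bumpE a : (bump k a < n.+1)%N = (a < n)%N by rewrite /bump; lia.
  have bumpB a : (n <= a)%N -> (bump k a - n.+1 = a - n)%N by rewrite /bump; lia.
  by rewrite /bordered !bumpE; do 2!case: ltnP => ?; rewrite ?bumpB.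
rewrite IH //; last exact: (generic_inj (@lift_inj _ k) genx).
rewrite mulrCA; congr (_ * _); rewrite mulr_sumr; apply: eq_bigr => w _.
rewrite odd_lift_perm /= -[in LHS](signr_odd _ k) signr_addb.
have -> : bordered n.+1 x B k (n + m).+1 = B k m.
  by rewrite /bordered ltn_ord ltnm subSS addKn.
rewrite [in RHS]big_mkcond big_ord_recl /= -big_mkcond lift_perm_id subSS subn0.
rewrite [X in _ = _ * (_ * X)]big_mkcond big_ord_recl /= mul1r -big_mkcond.
under [X in _ = _ * (_ * X * _)]eq_bigr => j _ do rewrite lift_perm_lift /bump /= add1n subSS.
under [X in _ = _ * (_ * X)]eq_bigr => i _.
  rewrite big_mkcond big_ord_recl /= mul1r -big_mkcond.
  under eq_bigr => j _ do rewrite !lift_perm_lift.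
  over.
by rewrite /= !mulrA; congr (_ * _ * _); rewrite mulrAC.
Qed.

End Schur.

(** * Symmetrized sums *)

(** The double product contains Y_j exactly min(m, j) times. With Y_j = 1 + beta x_j it comes from
    the denominators of [osub], and the second product from the border. *)
Lemma prod_powers (R : comPzRingType) (n m : nat) (Y : 'I_n -> R) :
  (m <= n)%N ->
  (\prod_(i < n | (i < m)%N) \prod_(j < n | (i < j)%N) Y j) *
  \prod_(j < n | (j < m)%N) Y j ^+ (m - j) = \prod_(j < n) Y j ^+ m.
Proof.
move=> mn; rewrite (exchange_big_dep xpredT) //= [X in _ * X]big_mkcond -big_split /=.
apply: eq_bigr => j _.
have -> : \prod_(i < n | (i < m)%N && (i < j)%N) Y j = Y j ^+ minn m j.
  rewrite -[in RHS](card_ord (minn m j)) -prodr_const.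
  rewrite (big_ord_widen n (fun=> Y j)); last by rewrite geq_min mn.
  by apply: eq_bigl => i; rewrite leq_min.
case: ltnP => jm; first by rewrite -exprD subnKC // ltnW.
by rewrite mulr1.
Qed.

Section Symmetrization.
Variables (F : fieldType) (beta : F).
Hypothesis F_char0 : forall n : nat, n.+1%:R != 0 :> F.
Variable pw : F -> nat -> F.
Hypothesis pw0 : forall z, pw z 0 = 1.

Lemma oadd_div_osub (x y : F) :
  oadd beta x y / osub beta x y = (ratio beta x y)^-1 * (1 + beta * y).
Proof. by rewrite /osub /ratio !invf_div mulrA mulrAC. Qed.

(* Positions beyond the length of lambda are interchangeable, so the extra factor
   of Gterm_rcons0 may be averaged over them. *)
Lemma Gterm_tperm (lam : seq nat) (n : nat) (y : 'I_n -> F) (p k : 'I_n) :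
  (size lam <= p)%N -> (size lam <= k)%N ->
  Gterm beta pw lam (fun i => y (tperm p k i)) = Gterm beta pw lam y.
Proof.
move=> lp lk; have fixt (i : 'I_n) : (i < size lam)%N -> tperm p k i = i.
  by move=> il; rewrite tpermD // -val_eqE /=; lia.
rewrite /Gterm; congr (_ * _); first by apply: eq_bigr => j /fixt->.
apply: eq_bigr => i il; rewrite [RHS](reindex_inj (@perm_inj _ (tperm p k))) /=.
apply: eq_big => [j|j _]; last by rewrite fixt.
by case: tpermP => // ->; lia.
Qed.

Lemma Gterm_rcons0 (lam : seq nat) (n : nat) (y : 'I_n -> F) (p : 'I_n) :
  p = size lam :> nat ->
  Gterm beta pw (rcons lam 0%N) y =
  Gterm beta pw lam y *
  \prod_(j < n | (p < j)%N) (oadd beta (y p) (y j) / osub beta (y p) (y j)).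
Proof.
move=> pl; rewrite /Gterm size_rcons.
rewrite (bigD1 p) /=; last by rewrite pl.
rewrite nth_rcons pl ltnn eqxx pw0 mul1r.
rewrite [X in _ * X = _](bigD1 p) /=; last by rewrite pl.
rewrite [X in _ * X = _]mulrC mulrA; congr (_ * _ * _); last first.
- by apply: eq_bigl => j; rewrite pl.
- by apply: eq_bigl => j; rewrite -val_eqE /= pl; lia.
have E (j : 'I_n) : (j < (size lam).+1)%N && (j != p) = (j < size lam)%N.
  by rewrite -val_eqE /= pl; lia.
by apply: eq_big => [j|j]; rewrite E // nth_rcons => ->.
Qed.

(** Divided by the product of all 1 + beta y_i with i >= p, this is [sum_ratio_inv] for those n - p
    variables. *)
Lemma sum_shifted_quotients (n : nat) (y : 'I_n -> F) (p : 'I_n) :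
  odd (n - p) -> generic beta y -> (forall i, 1 + beta * y i != 0) ->
  \sum_(k < n | (p <= k)%N)
    \prod_(j < n | (p <= j)%N && (j != k))
      (oadd beta (y k) (y j) / osub beta (y k) (y j)) = 1.
Proof.
move=> oddnp geny y1.
have [q qE] : exists q, (n - p = q.+1)%N by case: (n - p)%N oddnp => // q; exists q.
have lth (i : 'I_q.+1) : (p + i < n)%N by have := ltn_ord i; lia.
pose h i := Ordinal (lth i).
have h_inj : injective h by move=> i j [/addnI]; apply: val_inj.
(* The predicate [P] lets one bijection reindex both the sum and the inner products. *)
have hbij (P : pred 'I_n) :
    {on [pred k : 'I_n | (p <= k)%N && P k], bijective h}.
  exists (fun k : 'I_n => inord (k - p)) => i; rewrite inE.
    by move=> _; apply: val_inj; rewrite /= inordK addKn.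
  move=> /andP[pi _]; apply: val_inj; rewrite /= inordK ?subnKC //.
  by have := ltn_ord i; lia.
rewrite (eq_bigl (fun k : 'I_n => (p <= k)%N && xpredT k)); last first.
  by move=> k; rewrite andbT.
rewrite (reindex h) /=; last exact: hbij.
rewrite (eq_bigl xpredT); last by move=> i; rewrite leq_addr.
have geny' := generic_inj h_inj geny; have y1' i : 1 + beta * (y \o h) i != 0 by exact: y1.
have Y0 : \prod_i (1 + beta * (y \o h) i) != 0 by apply/prodf_neq0.
apply: (mulIf (invr_neq0 Y0)); rewrite mul1r -prodfV.
rewrite -[RHS](sum_ratio_inv F_char0 _ geny' y1'); last by rewrite -qE.
rewrite mulr_suml; apply: eq_bigr => k _.
rewrite (reindex h) /=; last exact: hbij.
rewrite (eq_bigl (fun i => i != k)); last first.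
  by move=> i; rewrite leq_addr (inj_eq h_inj).
under eq_bigr => i _ do rewrite oadd_div_osub.
rewrite big_split /= -mulrA; congr (_ * _).
rewrite [X in _ * X = _](bigD1 k) //= mulrCA -big_split /= big1 ?mulr1 // => i _.
by rewrite divff // y1'.
Qed.

(** Composing with [tperm p k] moves the special position from p to any k >= p without changing the
    sum. Adding up these n - r expressions, the extra factors sum to 1, and (n-r)! = (n-r) (n-r-1)!
    fixes the normalization. *)
Lemma Gsum_rcons0 (lam : seq nat) (n : nat) (x : 'I_n -> F) :
  odd (n - size lam) -> generic beta x -> (forall i, 1 + beta * x i != 0) ->
  Gsum beta pw (rcons lam 0%N) x = Gsum beta pw lam x.
Proof.
move=> oddnl genx x1.
have ltl : (size lam < n)%N by rewrite -subn_gt0; case: (n - _)%N oddnl.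
have [p pE] : exists p : 'I_n, p = size lam :> nat by exists (Ordinal ltl).
have lp : (size lam <= p)%N by rewrite pE.
rewrite /Gsum; set S := \sum_w Gterm _ _ (rcons _ _) _.
pose f (x y : F) := oadd beta x y / osub beta x y.
have Sk (k : 'I_n) : (p <= k)%N ->
    S = \sum_(w : 'S_n) Gterm beta pw lam (fun i => x (w i)) *
        \prod_(j < n | (p <= j)%N && (j != k)) f (x (w k)) (x (w j)).
  move=> pk; rewrite /S (reindex_inj (mulgI (tperm p k))) /=.
  apply: eq_bigr => w _; rewrite (@Gterm_rcons0 _ _ _ p) //.
  rewrite -(@Gterm_tperm lam n (fun i => x (w i)) p k) //; last exact: leq_trans pk.
  congr (_ * _).
    by rewrite /Gterm; congr (_ * _); repeat (apply: eq_bigr => ? _); rewrite ?permM.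
  rewrite [RHS](reindex_inj (@perm_inj _ (tperm p k))) /=.
  apply: eq_big => [j|j _]; last by rewrite !permM tpermL.
  case: tpermP => [->|->|/eqP jp /eqP jk].
  - by rewrite eqxx andbF ltnn.
  - by rewrite -val_eqE /=; lia.
  by move: jp jk; rewrite -!val_eqE /=; lia.
have E : (n - size lam)%:R * S = \sum_(w : 'S_n) Gterm beta pw lam (fun i => x (w i)).
  transitivity (\sum_(k < n | (p <= k)%N) S).
    rewrite sumr_const mulr_natl; congr (_ *+ _).
    have := cardC [pred k : 'I_n | (k < p)%N]; rewrite card_ord.
    have -> : #|[pred k : 'I_n | (k < p)%N]| = p.
      by rewrite -sum1_card -(big_ord_widen n (fun=> 1%N)) ?sum1_card ?card_ord // ltnW.
    move=> /(congr1 (subn^~ p)) /=; rewrite addKn -pE => <-; apply: eq_card => i.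
    by rewrite !inE -leqNgt.
  rewrite (eq_bigr _ Sk) exchange_big /=; apply: eq_bigr => w _.
  rewrite -mulr_sumr (sum_shifted_quotients (y := x \o w)) ?mulr1 ?pE //.
    exact: (generic_inj (@perm_inj _ w) genx).
  by move=> i; exact: x1.
rewrite size_rcons -E; have := oddnl; rewrite subnS.
case: (n - size lam)%N => // q _ /=; rewrite factS natrM invfM.
by rewrite -mulrA mulrCA mulKf.
Qed.

End Symmetrization.

(** * The formula at generic points *)

Section PfaffianFormula.
Variables (F : fieldType) (beta : F).
Hypothesis F_char0 : forall n : nat, n.+1%:R != 0 :> F.
Variable pw : F -> nat -> F.

(** The identity holds summand by summand in w: rewriting [vand] in the order given by w cancels the
    sign and all ratios whose first position is at least m. *)
Lemma Gsum_bordered (mu : seq nat) (n : nat) (x : nat -> F) :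
  let m := size mu in
  (m <= n)%N -> ~~ odd (n - m) -> generic beta (fun i : 'I_n => x i) ->
  (forall i : 'I_n, 1 + beta * x i != 0) ->
  Gsum beta pw mu (fun i : 'I_n => x i) =
  (\prod_(i < n) (1 + beta * x i) ^+ m) *
  (pfn (n + m) (bordered beta n x
     (fun i j => pw (x i) (nth 0%N mu (m - j.+1)) * (1 + beta * x i) ^- j.+1)) /
   vand beta n x).
Proof.
move=> m mn evennm genx x1.
rewrite pfn_bordered // /Gsum -[X in _ = _ * X]mulrA mulrCA; congr (_ * _).
rewrite mulr_suml mulr_sumr; apply: eq_bigr => w _.
have [_ _ xneq xadd] := genx.
pose g (i j : 'I_n) := ratio beta (x i) (x j).
have gC i j : g i j = - g j i by exact: ratioC.
have g0 i j : i != j -> g i j != 0.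
  by move=> ij; rewrite mulf_neq0 ?invr_eq0 ?subr_eq0 ?xneq ?xadd.
have -> : vand beta n x = (-1) ^+ w *
    (\prod_(i < n | (i < m)%N) \prod_(j < n | (i < j)%N) g (w i) (w j) *
     \prod_(i < n | (m <= i)%N) \prod_(j < n | (i < j)%N) g (w i) (w j)).
  transitivity ((-1) ^+ w * pair_prod (fun i j => g (w i) (w j))).
    by rewrite (pair_prod_perm w gC) mulrA -signr_addb addbb mul1r.
  congr (_ * _); rewrite /pair_prod (bigID (fun i : 'I_n => (i < m)%N)) /=.
  by congr (_ * _); apply: eq_bigl => i; rewrite -leqNgt.
have : \prod_(i < n | (m <= i)%N) \prod_(j < n | (i < j)%N) g (w i) (w j) != 0.
  apply/prodf_neq0 => i _; apply/prodf_neq0 => j ij.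
  by rewrite g0 // (inj_eq perm_inj) -val_eqE /= neq_ltn ij.
have : \prod_(i < n | (i < m)%N) \prod_(j < n | (i < j)%N) g (w i) (w j) != 0.
  apply/prodf_neq0 => i _; apply/prodf_neq0 => j ij.
  by rewrite g0 // (inj_eq perm_inj) -val_eqE /= neq_ltn ij.
have Y0 : \prod_(j < n | (j < m)%N) (1 + beta * x (w j)) ^+ (m - j) != 0.
  by apply/prodf_neq0 => j _; rewrite expf_neq0.
rewrite [X in _ = X * _](reindex_inj (@perm_inj _ w)) /=.
rewrite -(prod_powers (fun j => 1 + beta * x (w j)) mn).
(* Column m - j - 1 carries part j of [mu] and the exponent m - j that [prod_powers] supplies. *)
have -> : \prod_(j < n | (j < m)%N) (pw (x (w j)) (nth 0%N mu (m - (m - j.+1).+1)) *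
      (1 + beta * x (w j)) ^- (m - j.+1).+1) =
    (\prod_(j < n | (j < m)%N) pw (x (w j)) (nth 0%N mu j)) /
    \prod_(j < n | (j < m)%N) (1 + beta * x (w j)) ^+ (m - j).
  rewrite -prodfV -big_split /=; apply: eq_bigr => j jm.
  by rewrite subnSK // subKn // ltnW.
have -> : Gterm beta pw mu (fun i => x (w i)) =
    (\prod_(j < n | (j < m)%N) pw (x (w j)) (nth 0%N mu j)) *
    ((\prod_(i < n | (i < m)%N) \prod_(j < n | (i < j)%N) g (w i) (w j))^-1 *
     \prod_(i < n | (i < m)%N) \prod_(j < n | (i < j)%N) (1 + beta * x (w j))).
  congr (_ * _); rewrite -prodfV -big_split /=; apply: eq_bigr => i _.
  rewrite -prodfV -big_split /=; apply: eq_bigr => j _; exact: oadd_div_osub.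
move: Y0; set Y := \prod_(j < n | _) _ ^+ _ => Y0.
set P := \prod_(i < n | (i < m)%N) \prod_(j < n | _) g _ _ => P0.
set Q := \prod_(i < n | (m <= i)%N) \prod_(j < n | _) g _ _ => Q0.
have sg0 : (-1) ^+ w != 0 :> F by rewrite signr_eq0.
move: sg0; set sg := (-1) ^+ w => sg0.
set A := \prod_(j < n | _) pw _ _; set C := \prod_(i < n | _) \prod_(j < n | _) (1 + _).
by field; rewrite P0 Q0 Y0 sg0.
Qed.

Hypothesis pw0 : forall z, pw z 0 = 1.

Lemma Gsum_pfaffian (lam : seq nat) (n : nat) (x : 'I_n -> F) :
  let m := msize_lam lam n in
  (size lam <= n)%N -> generic beta x -> (forall i, 1 + beta * x i != 0) ->
  Gsum beta pw lam x =
  (\prod_(i < n) (1 + beta * x i) ^+ m) *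
  (Pf (Alam beta pw lam x) / Pf0 beta x).
Proof.
move=> m le_lam genx x1.
(* The default value 0 at index n is the variable appended in [Pf0] for odd n. *)
pose x' (i : nat) := oapp x 0 (insub i).
have x'E (i : 'I_n) : x' i = x i by rewrite /x' valK.
have x'n : x' n = 0 by rewrite /x' insubF ?ltnn.
have genx' : generic beta (fun i : 'I_n => x' i).
  have [? ? ? ?] := genx; split=> [i|i|i j ij|i j ij]; rewrite !x'E; auto.
have -> : Pf0 beta x = vand beta n x'.
  rewrite /Pf0; case: ifP => oddn.
    rewrite -schur_pfaffian_odd //; congr Pf; apply/matrixP => i j; rewrite !mxE.
    have E k : append0 x k = x' k.
      rewrite /append0; case: unliftP => [k' ->|->]; last by rewrite x'n.
      by rewrite lift_max x'E.
    by rewrite !E.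
  rewrite -schur_pfaffian ?oddn //; congr Pf; apply/matrixP => i j.
  by rewrite !mxE !x'E.
(* Padding gives length exactly m, and the default 0 of [nth] keeps all parts the same. *)
pose mu := if odd (n - size lam) then rcons lam 0%N else lam.
have sz_mu : size mu = m by rewrite /mu /m /msize_lam; case: ifP; rewrite ?size_rcons.
have nth_mu k : nth 0%N mu k = nth 0%N lam k.
  rewrite /mu; case: ifP => // _; rewrite nth_rcons; case: ltngtP => // kl.
    by rewrite nth_default // ltnW.
  by rewrite nth_default // kl.
have -> : Gsum beta pw lam x = Gsum beta pw mu x.
  by rewrite /mu; case: ifP => // oddnl; rewrite Gsum_rcons0.
have le_mn : (m <= n)%N.
  rewrite /m /msize_lam; case: ifP => // oddnl.
  by rewrite -subn_gt0; case: (n - _)%N oddnl.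
have evennm : ~~ odd (n - m).
  rewrite /m /msize_lam; case: ifP => [|->//].
  by rewrite subnS; case: (n - _)%N.
have -> : Gsum beta pw mu x = Gsum beta pw mu (fun i : 'I_n => x' i).
  congr (_ * _); apply: eq_bigr => w _; rewrite /Gterm; congr (_ * _).
    by apply: eq_bigr => j _; rewrite x'E.
  by apply: eq_bigr => i _; apply: eq_bigr => j _; rewrite !x'E.
have /= := @Gsum_bordered mu n x'; rewrite sz_mu => -> //; last first.
  by move=> i; rewrite x'E.
congr (_ * (_ / _)); first by apply: eq_bigr => i _; rewrite x'E.
congr Pf; apply/matrixP => i j; rewrite mxE /Alam -(splitK i) -(splitK j).
rewrite /bordered; case: (split i) => i'; case: (split j) => j' /=.
- by rewrite block_mxEul !mxE !ltn_ord !x'E.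
- by rewrite block_mxEur !mxE ltn_ord ltnNge leq_addr addKn /= x'E nth_mu.
- by rewrite block_mxEdl !mxE ltn_ord ltnNge leq_addr addKn /= x'E nth_mu.
by rewrite block_mxEdr !mxE !ltnNge !leq_addr.
Qed.

End PfaffianFormula.

(** * Genericity of the indeterminates *)

Section Indeterminates.
Variables (K : fieldType) (n : nat).
Implicit Types (c : K) (i j : 'I_n).

Lemma ratfun_char0 (p : nat) : [pchar K] =i pred0 -> p.+1%:R != 0 :> ratfun K n.
Proof.
move=> charK0; have -> : p.+1%:R = tofrac (p.+1%:R : {mpoly K[n]}).
  by rewrite rmorph_nat.
rewrite tofrac_eq0 -mpolyC_nat mpolyC_eq0.
by move/pcharf0P: charK0 => ->.
Qed.

Lemma tofrac_neq0_coeff (p : {mpoly K[n]}) m : p@_m != 0 -> tofrac p != 0.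
Proof.
by rewrite tofrac_eq0; apply: contra_neq => ->; rewrite mcoeff0.
Qed.

(** The constant coefficient is p + 1. The cases p = 0 and p = 1 give 1 + beta x and 2 + beta x. *)
Lemma natr_rconst_rvar_neq0 (p : nat) c i :
  [pchar K] =i pred0 -> p.+1%:R + rconst n c * rvar K i != 0.
Proof.
move=> /pcharf0P charK0.
rewrite -[p.+1%:R](rmorph_nat (@tofrac {mpoly K[n]})) /rconst /rvar -tofracM -tofracD.
apply: (@tofrac_neq0_coeff _ 0%MM).
rewrite mcoeffD -mpolyC_nat mcoeffC eqxx mulr1 mcoeffCM mcoeffX.
by rewrite mnm1_eq0 mulr0 addr0 charK0.
Qed.

(** Apart from 2 + beta x_i, each expression has coefficient 1 at the monomial x_i; in [oadd] the
    mixed term has degree 2 and does not interfere. *)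
Lemma generic_rvar c : [pchar K] =i pred0 -> generic (rconst n c) (@rvar K n).
Proof.
move=> charK0; split=> [i|i|i j ij|i j ij].
- by apply: (@tofrac_neq0_coeff _ U_(i)%MM); rewrite mcoeffX eqxx oner_neq0.
- exact: natr_rconst_rvar_neq0.
- rewrite -subr_eq0 -tofracB; apply: (@tofrac_neq0_coeff _ U_(i)%MM).
  by rewrite mcoeffB !mcoeffX eqxx eq_mnm1 [j == i]eq_sym (negPf ij) subr0 oner_neq0.
rewrite /oadd /rconst /rvar -!tofracM -!tofracD.
apply: (@tofrac_neq0_coeff _ U_(i)%MM).
rewrite !mcoeffD -mulrA mcoeffCM -mpolyXD !mcoeffX eqxx eq_mnm1 [j == i]eq_sym (negPf ij).
suff /negPf-> : (U_(i) + U_(j))%MM != U_(i)%MM by rewrite mulr0 !addr0 oner_neq0.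
by apply/eqP => /(congr1 mdeg); rewrite mdegD !mdeg1.
Qed.

End Indeterminates.

Unset Implicit Arguments.

Theorem theorem2p8 (K : fieldType) (charK0 : [pchar K] =i pred0)
    (beta : K) (b : nat -> K) (n : nat) (lam : seq nat)
    (lam_strict : strict_partition lam) (r_le_n : (size lam <= n)%N) :
  let m := msize_lam lam n in
  let x : 'I_n -> ratfun K n := @rvar K n in
  let be : ratfun K n := rconst n beta in
  let bb : nat -> ratfun K n := fun i => rconst n (b i) in
  GQ be bb lam x =
    (\prod_(i < n) (1 + be * x i) ^+ m) *
    (Pf (Alam be (powQ be bb) lam x) / Pf0 be x)
  /\
  GP be bb lam x =
    (\prod_(i < n) (1 + be * x i) ^+ m) *
    (Pf (Alam be (powP be bb) lam x) / Pf0 be x).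
Proof.
move=> m x be bb.
have char0 p := ratfun_char0 n p charK0.
have genx : generic be x by exact: generic_rvar.
have x1 i : 1 + be * x i != 0 by exact: (natr_rconst_rvar_neq0 0).
split; apply: Gsum_pfaffian => // z.
by rewrite /powP big_geq.
Qed.
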